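(* Let $\mathbb{F}$ be an infinite field of characteristic $p$, and let $n\geq 2$ and $d\geq 2$ be integers. (a) Assume that $2<p\leq n$. Then the invariant $\mathrm{tr}(X_1\cdots X_d)$ is indecomposable in $R^{O(n)}$, and $\mathrm{tr}(X_1^{+}\cdots X_d^{+})$ is indecomposable in $R_{+}^{O(n)}$. (b) Assume that $2<p\leq \frac{n-1}{2}$ and $d$ is even. Then the invariant $\mathrm{tr}(X_1^{-}\cdots X_d^{-})$ is indecomposable in $R_{-}^{O(n)}$.
   Context: Let $R=R_{n,d}=\mathbb{F}[x_{ij}(k)\,|\,1\leq i,j\leq n,\ 1\leq k\leq d]$ be the polynomial algebra, graded by total degree. For $1\leq k\leq d$ let $X_k$ be the generic $n\times n$ matrix with $(i,j)$ entry $x_{ij}(k)$. Let $X_k^{+}$ be the symmetric generic matrix: $(X_k^{+})_{ij}=x_{ij}(k)$ if $i\geq j$ and $(X_k^{+})_{ij}=x_{ji}(k)$ if $i<j$. Let $X_k^{-}$ be the skew-symmetric generic matrix: $(X_k^{-})_{ij}=x_{ij}(k)$ if $i>j$, $(X_k^{-})_{ij}=0$ if $i=j$, and $(X_k^{-})_{ij}=-x_{ji}(k)$ if $i<j$. For an $n\times n$ matrix $A$, $\sigma_t(A)$ ($1\le t\le n$) denotes the $t$-th coefficient of the characteristic polynomial of $A$ (so $\sigma_1=\mathrm{tr}$ and $\sigma_n=\det$). $R^{O(n)}$ (the algebra of matrix $O(n)$-invariants) is the unital $\mathbb{F}$-subalgebra of $R$ generated by all $\sigma_t(A)$, where $1\leq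 t\leq n$ and $A$ ranges over all monomials in $X_1,\ldots,X_d,X_1^T,\ldots,X_d^T$. $R_{+}^{O(n)}$ (respectively $R_{-}^{O(n)}$) is the unital subalgebra of $R$ generated by all $\sigma_t(A)$, $1\le t\le n$, where $A$ ranges over all monomials in $X_1^{+},\ldots,X_d^{+}$ (respectively in $X_1^{-},\ldots,X_d^{-}$). All are $\mathbb{N}$-graded by degree with degree-zero component $\mathbb{F}$. For an $\mathbb{N}$-graded unital algebra $\mathcal{A}$ with degree-zero component $\mathbb{F}$, let $\mathcal{A}^{+}$ be the subalgebra (without unit) generated by the homogeneous elements of positive degree. An element $a\in\mathcal{A}$ is decomposable if its image in $\overline{\mathcal{A}}=\mathcal{A}/(\mathcal{A}^{+})^2$ is zero, i.e. $a\in(\mathcal{A}^{+})^2$; otherwise it is indecomposable. *)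

(* Defs.v *)
From HB Require Import structures.
From mathcomp Require Import all_boot all_order all_algebra.
From mathcomp Require Import classical_sets cardinality.
From mathcomp Require Import mpoly.

Set Implicit Arguments.
Unset Strict Implicit.
Unset Printing Implicit Defensive.

Import GRing.Theory.
Local Open Scope ring_scope.

Section Subalgebras.
Variables (F : nzRingType) (A : lalgType F).
Implicit Types S U V : A -> Prop.

Inductive subalg_gen S : A -> Prop :=
| SubalgGen a : S a -> subalg_gen S a
| SubalgScalar (c : F) : subalg_gen S c%:A
| SubalgAdd a b : subalg_gen S a -> subalg_gen S b -> subalg_gen S (a + b)
| SubalgMul a b : subalg_gen S a -> subalg_gen S b -> subalg_gen S (a * b).

Inductive nonunital_subalg_gen S : A -> Prop :=
| NusubalgGen a : S a -> nonunital_subalg_gen S a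
| NusubalgZero : nonunital_subalg_gen S 0
| NusubalgScale (c : F) a :
    nonunital_subalg_gen S a -> nonunital_subalg_gen S (c *: a)
| NusubalgAdd a b :
    nonunital_subalg_gen S a -> nonunital_subalg_gen S b ->
    nonunital_subalg_gen S (a + b)
| NusubalgMul a b :
    nonunital_subalg_gen S a -> nonunital_subalg_gen S b ->
    nonunital_subalg_gen S (a * b).

(* The product U V of two subspaces: finite sums of products u v. *)
Definition subspace_prod U V (a : A) : Prop :=
  exists s : seq (A * A),
    (forall uv, uv \in s -> U uv.1 /\ V uv.2) /\
    a = \sum_(uv <- s) uv.1 * uv.2.

End Subalgebras.

Section Decomposability.
Variables (F : fieldType) (m : nat).
(* A graded subalgebra of the polynomial algebra, with the degree grading. *)
Variable A : {mpoly F[m]} -> Prop.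

Definition aug_ideal : {mpoly F[m]} -> Prop :=
  nonunital_subalg_gen
    (fun f => A f /\ exists2 k : nat, (0 < k)%N & f \is k.-homog).

Definition decomposable (f : {mpoly F[m]}) : Prop :=
  A f /\ subspace_prod aug_ideal aug_ideal f.

Definition indecomposable (f : {mpoly F[m]}) : Prop :=
  A f /\ ~ decomposable f.

End Decomposability.

Notation nvars n d := #|{: 'I_n * 'I_n * 'I_d}|.
Notation polyR F n d := {mpoly F[nvars n d]}.

Section GenericMatrices.
Variables (F : fieldType) (n d : nat).
Local Notation R := (polyR F n d).

Definition xvar (i j : 'I_n) (k : 'I_d) : R := 'X_(enum_rank (i, j, k)).

Definition genX (k : 'I_d) : 'M[R]_n := \matrix_(i, j) xvar i j k.

Definition genXsym (k : 'I_d) : 'M[R]_n :=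
  \matrix_(i, j) if (j <= i)%N then xvar i j k else xvar j i k.

Definition genXskew (k : 'I_d) : 'M[R]_n :=
  \matrix_(i, j) if (j < i)%N then xvar i j k
                 else if i == j then 0 else - xvar j i k.

(* char_poly M = det (X - M) = \sum_t (-1)^t sigma_t(M) X^(n - t), so that
   sigma_1 is the trace and sigma_n the determinant. *)
Definition sigma (t : nat) (M : 'M[R]_n) : R :=
  (-1) ^+ t * (char_poly M)`_(n - t).

(* The empty monomial 1 is allowed; it contributes only the scalars
   sigma_t(1) = 'C(n, t), which belong to every unital subalgebra. *)
Definition sigma_monomial (I : Type) (G : I -> 'M[R]_n) (f : R) : Prop :=
  exists (t : nat) (w : seq I),
    (1 <= t <= n)%N /\ f = sigma t (\prod_(i <- w) G i).

Definition inv_O : R -> Prop :=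
  subalg_gen (sigma_monomial (fun l : 'I_d + 'I_d =>
    match l with inl k => genX k | inr k => (genX k)^T end)).

Definition inv_O_sym : R -> Prop := subalg_gen (sigma_monomial genXsym).

Definition inv_O_skew : R -> Prop := subalg_gen (sigma_monomial genXskew).

End GenericMatrices.

(* Main.v *)
Require Import Defs.
From HB Require Import structures.
From mathcomp Require Import all_boot all_order all_algebra.
From mathcomp Require Import classical_sets cardinality.
From mathcomp Require Import mpoly.
From mathcomp Require Import zify.

Set Implicit Arguments.
Unset Strict Implicit.
Unset Printing Implicit Defensive.

Import GRing.Theory.
Local Open Scope ring_scope.

(** The invariant [tr (X_1 ... X_d)] is detected by one specialization into
    [F[t_1, ..., t_d]]: send [X_k] to [t_k D] for [k < d] and [X_d] to [t_d E],
    where [D] and [E] are matrices over [F], of the required symmetry type, with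
    [tr (D^r) = 0] for every [r > 0] and [tr (D^(d-1) E) != 0].

    Only squarefree monomials in the [t_k] are looked at.  A word in the generic
    matrices goes to [t^m P], where [t^m] is the product of the variables of its
    letters and [P] is a product of copies of [D] and [E].  As [sigma_t] is
    homogeneous of degree [t] (lemma [coef_char_poly_scale]),
    [sigma_t (t^m P) = (t^m)^t sigma_t(P)].  If this has a nonconstant
    squarefree monomial, then [t = 1], and if moreover that monomial does not
    involve [t_d], then [P = D^r] with [r > 0] and the coefficient is
    [tr (D^r) = 0].  Hence in the image of an invariant without constant term
    every squarefree monomial with nonzero coefficient involves [t_d]; a product
    of two such images has no squarefree monomial at all
    (lemma [aug_vanishingM]), so neither does the image of a decomposable
    invariant.  But [tr (X_1 ... X_d)] goes to
    [tr (D^(d-1) E) t_1 ... t_d], which is not zero.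

    The characteristic makes suitable [D] and [E] available.  For arbitrary and
    for symmetric matrices, [D] is the diagonal idempotent of rank [p] and [E]
    that of rank [1], so that [tr (D^r) = p = 0].  For skew-symmetric matrices,
    [D] consists of [p] diagonal blocks [J] of size 2, with [J^2 = -1], and [E]
    of one such block.  Then [tr (D^r)] is [0] for odd [r] and [2p] up to sign
    for even [r], while [tr (D^(d-1) E)] is [2] up to sign when [d] is even,
    and [2 != 0] in [F]. *)

(** * Homogeneity of the coefficients of the characteristic polynomial *)

Lemma coef_comp_scaleX (R : comNzRingType) (q : {poly R}) (a : R) (i : nat) :
  (q \Po (a *: 'X))`_i = a ^+ i * q`_i.
Proof.
rewrite comp_polyE coef_sum.
under eq_bigr => j _ do rewrite exprZn !coefZ coefXn.
have [lt_iq|le_qi] := ltnP i (size q); last first.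
  rewrite [q`_i]nth_default // mulr0 big1 // => j _.
  by rewrite gtn_eqF ?mulr0 // (leq_trans (ltn_ord j)).
rewrite (bigD1 (Ordinal lt_iq)) //= eqxx mulr1 mulrC big1 ?addr0 // => j.
by rewrite -val_eqE /= eq_sym => /negPf ->; rewrite !mulr0.
Qed.

(** Substituting [aX] for [X] in [det (X - aM)] gives [a^n det (X - M)];
    comparing coefficients and cancelling [a^(n-t)] proves that [sigma_t] is
    homogeneous of degree [t]. *)
Lemma coef_char_poly_scale (R : idomainType) (n t : nat) (a : R) (M : 'M[R]_n) :
  a != 0 -> (t <= n)%N ->
  (char_poly (a *: M))`_(n - t) = a ^+ t * (char_poly M)`_(n - t).
Proof.
move=> nz_a le_tn.
have comp_char : char_poly (a *: M) \Po (a *: 'X) = a%:P ^+ n * char_poly M.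
  rewrite -[_ \Po _]/(comp_poly (a *: 'X) _) -det_map_mx -detZ; congr (\det _).
  apply/matrixP=> i j; rewrite !mxE /= comp_polyB comp_polyC polyCM mulrBr.
  by rewrite -mul_polyC raddfMn /= comp_polyX mulrnAr mul_polyC.
apply: (mulfI (expf_neq0 (n - t) nz_a)).
rewrite -coef_comp_scaleX comp_char -polyC_exp coefCM mulrA -exprD.
by rewrite subnK.
Qed.

Lemma sigma1_tr (F : fieldType) (n d : nat) (M : 'M[polyR F n d]_n) :
  (0 < n)%N -> sigma 1 M = \tr M.
Proof.
by move=> n_gt0; rewrite /sigma subn1 char_poly_trace // expr1 mulN1r opprK.
Qed.

Lemma prod_scale_map (F : fieldType) (n d : nat) (I : Type) (c : I -> 'I_d)
    (N : I -> 'M[F]_n) (w : seq I) :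
  \prod_(i <- w) ('X_(c i) *: map_mx (@mpolyC d F) (N i)) =
  'X_[\sum_(i <- w) U_(c i)] *: map_mx (@mpolyC d F) (\prod_(i <- w) N i).
Proof.
elim: w => [|i w IHw]; first by rewrite !big_nil mpolyX0 scale1r rmorph1.
rewrite !big_cons IHw rmorphM mpolyXD.
by rewrite -!mulmxE -scalemxAl -scalemxAr scalerA.
Qed.

Lemma sum_mnm1E (d : nat) (I : Type) (c : I -> 'I_d) (w : seq I) (k : 'I_d) :
  (\sum_(i <- w) U_(c i))%MM k = count_mem k (map c w).
Proof.
rewrite mnm_sumE; elim: w => [|i w IHw]; first by rewrite big_nil.
by rewrite big_cons IHw mnm1E.
Qed.

(** * Squarefree coefficients *)

Section SquarefreeCoefficients.
Variables (F : fieldType) (d : nat) (k0 : 'I_d).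
Local Notation T := {mpoly F[d]}.

Definition squarefree (m : 'X_{1..d}) : Prop := forall k, (m k <= 1)%N.

Lemma squarefreeD (m1 m2 : 'X_{1..d}) :
  squarefree (m1 + m2)%MM -> squarefree m1 /\ squarefree m2.
Proof.
move=> sq; split=> k; have := sq k; rewrite mnmDE; apply: leq_trans.
  exact: leq_addr.
exact: leq_addl.
Qed.

(** In the quotient by all [t_k^2], this says that [g] is a constant modulo the
    ideal generated by [t_k0]. *)
Definition vanishing (g : T) : Prop :=
  forall m : 'X_{1..d}, squarefree m -> m k0 = 0%N -> m != 0%MM -> g@_m = 0.

Lemma vanishingC (c : F) : vanishing c%:MP.
Proof. by move=> m _ _ nz_m; rewrite mcoeffC (negPf nz_m) mulr0. Qed.

Lemma vanishingD g h : vanishing g -> vanishing h -> vanishing (g + h).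
Proof. by move=> Vg Vh m *; rewrite mcoeffD Vg ?Vh ?addr0. Qed.

Lemma mcoeffM_eq0 (g h : T) (m : 'X_{1..d}) :
  (forall m1 m2, m = (m1 + m2)%MM -> g@_m1 * h@_m2 = 0) -> (g * h)@_m = 0.
Proof. by move=> gh0; rewrite mcoeffM big1 // => -[m1 m2] /= /eqP /gh0. Qed.

Lemma vanishingM g h : vanishing g -> vanishing h -> vanishing (g * h).
Proof.
move=> Vg Vh m sq_m m_k0 nz_m; apply: mcoeffM_eq0 => m1 m2 def_m.
move: sq_m m_k0 nz_m; rewrite {}def_m => /squarefreeD[sq1 sq2] /eqP.
rewrite mnmDE addn_eq0 => /andP[/eqP m1_k0 /eqP m2_k0].
have [->|nz_m1 _] := eqVneq m1 0%MM; last by rewrite Vg ?mul0r.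
by rewrite add0m => nz_m2; rewrite [h@_m2]Vh ?mulr0.
Qed.

(** In the quotient by all [t_k^2], both factors lie in the ideal generated by
    [t_k0], whose square is zero. *)
Lemma aug_vanishingM g h m :
  vanishing g -> g@_0 = 0 -> vanishing h -> h@_0 = 0 ->
  squarefree m -> (g * h)@_m = 0.
Proof.
move=> Vg g0 Vh h0 sq_m; apply: mcoeffM_eq0 => m1 m2 def_m.
move: sq_m; rewrite {}def_m => sq_m; have [sq1 sq2] := squarefreeD sq_m.
have kill (q : T) m' : vanishing q -> q@_0 = 0 -> squarefree m' ->
    m' k0 = 0%N -> q@_m' = 0.
  by move=> Vq q0 sq m'_k0; have [->|/Vq->] := eqVneq m' 0%MM.
have := sq_m k0; rewrite mnmDE.
case m1_k0: (m1 k0) => [|e]; first by rewrite (kill g) ?mul0r.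
rewrite addSn ltnS leqn0 addn_eq0 => /andP[_ /eqP m2_k0].
by rewrite (kill h) ?mulr0.
Qed.

End SquarefreeCoefficients.

(** * Specialization to multiples of matrices over the base field *)

Section Specialization.
Variables (F : fieldType) (n d : nat) (N : 'I_d -> 'M[F]_n).
Local Notation R := (polyR F n d).
Local Notation T := {mpoly F[d]}.

Definition spec_var (v : 'I_(nvars n d)) : T :=
  let: (i, j, k) := enum_val v in N k i j *: 'X_k.

Definition spec : R -> T := comp_mpoly [tuple spec_var v | v < nvars n d].
HB.instance Definition _ := GRing.RMorphism.on spec.

Lemma specZ (c : F) (f : R) : spec (c *: f) = c *: spec f.
Proof. exact: comp_mpolyZ. Qed.

Lemma spec_xvar i j k : spec (xvar F i j k) = N k i j *: 'X_k.
Proof.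
by rewrite /spec /xvar comp_mpolyXU -tnth_nth tnth_mktuple /spec_var enum_rankK.
Qed.

(** Variables go to linear forms, so constant terms are kept. *)
Lemma spec_coef0 f : (spec f)@_0 = f@_0.
Proof.
rewrite /spec comp_mpolyEX raddf_sum /= [in RHS](mpolyE f) raddf_sum /=.
apply: eq_bigr => m _; rewrite !mcoeffZ mcoeffX; congr (_ * _).
rewrite comp_mpolyX rmorph_prod /=.
have [->|] := eqVneq m 0%MM.
  by rewrite big1 // => i _; rewrite mnm0E expr0 mcoeff1 eqxx.
rewrite -mdeg_eq0 mdegE sum_nat_eq0 negb_forall => /existsP[i /= nz_mi].
rewrite (bigD1 i) //= rmorphXn /= tnth_mktuple /spec_var.
case: (enum_val i) => -[a b] k; rewrite mcoeffZ mcoeffX.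
rewrite -mdeg_eq0 mdeg1 mulr0 expr0n (negPf nz_mi).
by rewrite mul0r.
Qed.

Variable k0 : 'I_d.
Local Notation vanishing := (vanishing k0).

Lemma spec_subalg (S : R -> Prop) :
  (forall f, S f -> vanishing (spec f)) ->
  forall f, subalg_gen S f -> vanishing (spec f).
Proof.
move=> VS f; elim=> {f} [f /VS //|c|f g _ Vf _ Vg|f g _ Vf _ Vg].
- by rewrite specZ rmorph1 -mul_mpolyC mulr1; apply: vanishingC.
- by rewrite rmorphD; apply: vanishingD.
- by rewrite rmorphM; apply: vanishingM.
Qed.

Lemma spec_aug (A : R -> Prop) :
  (forall f, A f -> vanishing (spec f)) ->
  forall f, aug_ideal A f -> vanishing (spec f) /\ (spec f)@_0 = 0.
Proof.
move=> VA f; elim=> {f}.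
- move=> f [/VA Vf [k k_gt0 hom_f]]; split=> //; rewrite spec_coef0.
  by apply: dhomog_nemf_coeff hom_f _; rewrite /= mdeg0 ltn_eqF.
- by rewrite rmorph0 mcoeff0; split=> // m *; rewrite mcoeff0.
- move=> c f _ [Vf f0]; rewrite specZ mcoeffZ f0 mulr0; split=> //.
  by move=> m *; rewrite mcoeffZ Vf ?mulr0.
- move=> f g _ [Vf f0] _ [Vg g0]; rewrite rmorphD mcoeffD f0 g0 addr0.
  by split=> //; apply: vanishingD.
- move=> f g _ [Vf f0] _ [Vg g0]; rewrite rmorphM; split.
    exact: vanishingM.
  by rewrite rmorphM /= f0 mul0r.
Qed.

Lemma spec_decomposable (A : R -> Prop) f m :
  (forall g, A g -> vanishing (spec g)) -> decomposable A f ->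
  squarefree m -> (spec f)@_m = 0.
Proof.
move=> VA [_ [s [s_aug ->]]] sq_m.
rewrite (rmorph_sum spec) (raddf_sum (mcoeff m)) big_seq big1 //=.
move=> uv /s_aug[/(spec_aug VA)[Vu u0] /(spec_aug VA)[Vv v0]].
by rewrite rmorphM; apply: (aug_vanishingM Vu u0 Vv v0).
Qed.

Section Generators.
Variables (I : Type) (G : I -> 'M[R]_n) (c : I -> 'I_d).
Hypothesis specG :
  forall i, map_mx spec (G i) = 'X_(c i) *: map_mx (@mpolyC d F) (N (c i)).

Lemma spec_prod (w : seq I) :
  map_mx spec (\prod_(i <- w) G i) =
  'X_[\sum_(i <- w) U_(c i)] *: map_mx (@mpolyC d F) (\prod_(i <- w) N (c i)).
Proof.
rewrite rmorph_prod /=; under eq_bigr => i _ do rewrite specG.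
exact: prod_scale_map.
Qed.

Hypothesis tr_avoid : forall w : seq 'I_d,
  w != [::] -> k0 \notin w -> \tr (\prod_(k <- w) N k) = 0.

(** The image is [(t^m)^t sigma_t(P)]: a nonconstant squarefree monomial forces
    [t = 1], and then the coefficient is, up to the convention on signs, the
    trace of a product of the matrices [N k] with [k != k0]. *)
Lemma vanishing_sigma f : sigma_monomial G f -> vanishing (spec f).
Proof.
case=> t [w [/andP[t_gt0 le_tn] ->]] m sq_m m_k0 nz_m.
set mw : 'X_{1..d} := (\sum_(i <- w) U_(c i))%MM.
set P : 'M[F]_n := \prod_(i <- w) N (c i).
have -> : spec (sigma t (\prod_(i <- w) G i)) =
    ((-1) ^+ t * (char_poly P)`_(n - t)) *: 'X_[mw *+ t].
  rewrite /sigma rmorphM rmorphXn rmorphN1 /= -coef_map map_char_poly spec_prod.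
  rewrite coef_char_poly_scale -?msupp_eq0 ?msuppX //.
  rewrite -(map_char_poly (@mpolyC d F)) coef_map /=.
  rewrite mpolyXn mulrC -mulrA [_ * (-1) ^+ t]mulrC -mul_mpolyC mulrC.
  by rewrite rmorphM rmorphXn rmorphN1.
rewrite mcoeffZ mcoeffX; have [def_m|_] := eqVneq; last by rewrite mulr0.
have mE k : (m k = mw k * t)%N by rewrite -def_m mulmnE.
have t1 : t = 1%N.
  (* A variable of [m] occurs there with exponent [mw k * t = 1]. *)
  have [k nz_k] : exists k, m k != 0%N.
    apply/existsP; apply: contraNT nz_m; rewrite negb_exists => /forallP m0.
    by apply/eqP/mnmP=> k; rewrite mnm0E; apply/eqP; rewrite -[_ == _]negbK.
  have : m k == 1%N by rewrite eqn_leq sq_m lt0n.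
  by rewrite mE muln_eq1 => /andP[_ /eqP].
have mwE : m = mw by apply/mnmP=> k; rewrite mE t1 muln1.
have nz_w : map c w != [::].
  apply: contraNneq nz_m; rewrite mwE /mw.
  rewrite -(big_map c xpredT (fun k => U_(k)%MM)) => ->.
  by rewrite big_nil.
have k0_w : k0 \notin map c w.
  by rewrite -has_pred1 has_count -sum_mnm1E -/mw -mwE m_k0.
rewrite t1 subn1 char_poly_trace -?t1 ?(leq_trans t_gt0) // /P.
by rewrite -(big_map c xpredT N) tr_avoid // oppr0 mulr0 mul0r.
Qed.

(** The word has distinct letters, so its trace goes to a nonzero multiple of a
    squarefree monomial, which no decomposable element contains. *)
Lemma indecomposable_trace (w : seq I) :
  (0 < n)%N -> uniq (map c w) -> \tr (\prod_(k <- map c w) N k) != 0 ->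
  indecomposable (subalg_gen (sigma_monomial G)) (\tr (\prod_(i <- w) G i)).
Proof.
move=> n_gt0 uniq_w nz_tr; split.
  apply: SubalgGen; exists 1%N, w; split; first exact: n_gt0.
  by rewrite sigma1_tr.
set m : 'X_{1..d} := (\sum_(i <- w) U_(c i))%MM.
have sq_m : squarefree m.
  by move=> k; rewrite /m sum_mnm1E count_uniq_mem // leq_b1.
move=> dec; have := spec_decomposable (spec_subalg vanishing_sigma) dec sq_m.
rewrite -trace_map_mx spec_prod mxtraceZ trace_map_mx mulrC mul_mpolyC.
rewrite mcoeffZ mcoeffX eqxx mulr1 -(big_map c xpredT N).
exact/eqP.
Qed.
End Generators.
End Specialization.

(** Transposes and the symmetric and skew-symmetric generic matrices are
    specialized through the same variables as the plain generic matrices, so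
    [N k] has to share their symmetry. *)
Section SpecGeneric.
Variables (F : fieldType) (n d : nat) (N : 'I_d -> 'M[F]_n) (k : 'I_d).

Lemma spec_genX :
  map_mx (spec N) (genX F n k) = 'X_k *: map_mx (@mpolyC d F) (N k).
Proof.
by apply/matrixP=> i j; rewrite !mxE spec_xvar -mul_mpolyC mulrC.
Qed.

Lemma spec_genX_tr : (N k)^T = N k ->
  map_mx (spec N) (genX F n k)^T = 'X_k *: map_mx (@mpolyC d F) (N k).
Proof.
by move=> symN; rewrite -map_trmx spec_genX linearZ /= map_trmx symN.
Qed.

Lemma spec_genXsym : (N k)^T = N k ->
  map_mx (spec N) (genXsym F n k) = 'X_k *: map_mx (@mpolyC d F) (N k).
Proof.
move=> symN; apply/matrixP=> i j; rewrite !mxE mulrC mul_mpolyC.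
by case: ifP => _; rewrite spec_xvar // -{1}symN mxE.
Qed.

Lemma spec_genXskew : (N k)^T = - N k -> (forall i, N k i i = 0) ->
  map_mx (spec N) (genXskew F n k) = 'X_k *: map_mx (@mpolyC d F) (N k).
Proof.
move=> skewN diagN; apply/matrixP=> i j; rewrite !mxE mulrC mul_mpolyC.
case: ifP => _; first by rewrite spec_xvar.
case: eqVneq => [->|_]; first by rewrite diagN scale0r rmorph0.
have -> : N k i j = - N k j i by move/matrixP/(_ j i): skewN; rewrite !mxE.
by rewrite rmorphN /= spec_xvar scaleNr.
Qed.

End SpecGeneric.

Definition pair_family (F : fieldType) (n d : nat) (D E : 'M[F]_n)
  (k : 'I_d.+1) : 'M[F]_n := if k == ord_max then E else D.

(** A word that avoids the last variable specializes to a power of [D], while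
    the product of all the generic matrices ends with the only factor [E]. *)
Lemma indecomposable_trace_pair (F : fieldType) (n d : nat) (D E : 'M[F]_n)
    (I : Type) (G : I -> 'M[polyR F n d.+1]_n) (c : I -> 'I_d.+1) (w : seq I) :
  (0 < n)%N ->
  (forall i, map_mx (spec (pair_family D E)) (G i) =
     'X_(c i) *: map_mx (@mpolyC d.+1 F) (pair_family D E (c i))) ->
  (forall r, \tr (D ^+ r.+1) = 0) -> \tr (D ^+ d * E) != 0 ->
  map c w = index_enum 'I_d.+1 ->
  indecomposable (subalg_gen (sigma_monomial G)) (\tr (\prod_(i <- w) G i)).
Proof.
move=> n_gt0 specG trD nz_tr cw.
apply: (indecomposable_trace (k0 := ord_max) specG) => //.
- case=> // k u _; rewrite /pair_family => avoid.
  under eq_big_seq => l ul do rewrite (negPf (memPn avoid l ul)).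
  by rewrite big_const_seq count_predT iter_mulr_1 trD.
- by rewrite cw index_enum_uniq.
- rewrite cw big_ord_recr /= {2}/pair_family eqxx.
  under eq_bigr => k _.
    by rewrite /pair_family -val_eqE /= ltn_eqF ?ltn_ord //; over.
  by rewrite prodr_const card_ord.
Qed.

(** * The matrices of the two specializations *)

Lemma mxtrace_pid (F : fieldType) (n r : nat) :
  (r <= n)%N -> \tr (pid_mx r : 'M[F]_n) = r%:R.
Proof.
move=> le_rn; rewrite /mxtrace.
under eq_bigr => i _ do rewrite mxE eqxx /=.
rewrite -natr_sum; congr _%:R; rewrite -big_mkcond /=.
by rewrite -(big_ord_widen n (fun=> 1%N) le_rn) sum1_card card_ord.
Qed.

Lemma pid_mxX (F : fieldType) (n r e : nat) :
  (pid_mx r : 'M[F]_n) ^+ e.+1 = pid_mx r.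
Proof.
elim: e => // e IHe; rewrite exprS IHe -mulmxE mul_pid_mx minnn.
by apply/matrixP=> i j; rewrite !mxE ltn_min ltn_ord.
Qed.

(** The block-diagonal matrix with [r] blocks [[0, -1], [1, 0]] followed by
    zeros: block number [i./2] has rows [2 i./2] and [2 i./2 + 1], told apart by
    the parity of [i]. *)
Definition skew_blocks (F : fieldType) (n r : nat) : 'M[F]_n :=
  \matrix_(i, j) (((i./2 < r)%N && (i./2 == j./2))%:R *
                  ((odd i)%:R - (odd j)%:R)).

Section SkewBlocks.
Variables (F : fieldType) (n : nat).
Local Notation S := (skew_blocks F n).

Lemma tr_skew_blocks r : (S r)^T = - S r.
Proof.
apply/matrixP=> i j; rewrite !mxE -mulrN opprB; congr (_%:R * _).
by rewrite eq_sym; case: eqVneq => [->|]; rewrite ?andbF.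
Qed.

Lemma skew_blocks_diag r i : S r i i = 0.
Proof. by rewrite mxE subrr mulr0. Qed.

Lemma mul_skew_blocks a b : (a.*2 <= n)%N ->
  S a *m S b = - pid_mx (minn a b).*2.
Proof.
move=> le_an; apply/matrixP=> i j; rewrite !mxE.
have -> : (i < (minn a b).*2)%N = (i./2 < a)%N && (i./2 < b)%N.
  by rewrite -leq_min; lia.
have [lt_ia|] /= := boolP (i./2 < a)%N; last first.
  move=> /negPf ge_ia; rewrite andbF oppr0 big1 // => k _.
  by rewrite mxE ge_ia mul0r mul0r.
have lt_i' : ((if odd i then i.-1 else i.+1) < n)%N.
  by case: ifP => odd_i; have := ltn_ord i; lia.
(* The only index in the same block as [i] and of the other parity. *)
pose i' := Ordinal lt_i'.
have [half_i' odd_i'] : i'./2 = i./2 /\ odd i' = ~~ odd i.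
  by rewrite /i' /=; case: ifP => odd_i; split; lia.
rewrite (bigD1 i') //= big1 ?addr0 => [|k ne_k]; last first.
  rewrite mxE; case: eqP => [half_k|_]; last by rewrite andbF mul0r mul0r.
  suff -> : odd i = odd k by rewrite subrr mulr0 mul0r.
  move: ne_k; rewrite -val_eqE /=; case: ifP; lia.
rewrite !mxE lt_ia half_i' eqxx odd_i' mul1r.
have -> : (i == j :> nat) = (i./2 == j./2) && (odd i == odd j) by lia.
case: (i./2 < b)%N (i./2 == j./2) => [] [] /=;
  rewrite ?andbF ?mul0r ?mulr0 ?oppr0 ?mul1r //.
by case: (odd i) (odd j) => [] [];
  rewrite /= ?subr0 ?sub0r ?subrr ?mulr0 ?mulr1 ?mul1r ?mulrNN ?mulrN ?oppr0.
Qed.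

Lemma mul_pid_skew_blocks r : pid_mx r.*2 *m S r = S r.
Proof.
apply/matrixP=> i j; rewrite !mxE (bigD1 i) //= big1 ?addr0 => [|k ne_ki].
  rewrite !mxE eqxx /=; case: (ltnP i./2 r) => /= [lt_ir|_].
    have -> : (i < r.*2)%N by lia.
    by rewrite mul1r.
  by rewrite !mul0r mulr0.
by rewrite mxE eq_sym (val_eqE k i) (negPf ne_ki) mul0r.
Qed.

(** The square of [S r] is minus an idempotent that fixes [S r]. *)
Lemma skew_blocksX r q : (r.*2 <= n)%N ->
  S r ^+ q.*2.+1 = (-1) ^+ q *: S r.
Proof.
move=> le_rn; elim: q => [|q IHq]; first by rewrite expr1 scale1r.
rewrite doubleS exprS exprS IHq mulrA -!mulmxE mul_skew_blocks // minnn mulNmx.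
by rewrite -scalemxAr mul_pid_skew_blocks exprS mulN1r scaleNr.
Qed.

Lemma mxtrace_skew_blocks r : \tr (S r) = 0.
Proof. by rewrite /mxtrace big1 // => i _; rewrite skew_blocks_diag. Qed.

Lemma mxtrace_skew_blocksM a b : (a.*2 <= n)%N ->
  \tr (S a *m S b) = - (minn a b).*2%:R.
Proof.
move=> le_an; rewrite mul_skew_blocks // raddfN /= mxtrace_pid //.
by rewrite (leq_trans _ le_an) // leq_double geq_minl.
Qed.

(** Odd powers have zero diagonal; even powers are, up to sign, an idempotent of
    rank [2r]. *)
Lemma mxtrace_skew_blocksX r e : (r.*2 <= n)%N -> r%:R = 0 :> F ->
  \tr (S r ^+ e.+1) = 0.
Proof.
move=> le_rn r0; rewrite -[e]odd_double_half; case: (odd e).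
  rewrite exprS skew_blocksX // -mulmxE -scalemxAr mxtraceZ.
  by rewrite mxtrace_skew_blocksM // minnn -muln2 natrM r0 mul0r oppr0 mulr0.
by rewrite skew_blocksX // mxtraceZ mxtrace_skew_blocks mulr0.
Qed.

End SkewBlocks.

(** * Indecomposability *)

Theorem theorem1p1 (F : fieldType) (p n d : nat)
    (F_infinite : infinite_set [set: F]) (pcharF : p \in [pchar F])
    (n_ge2 : (2 <= n)%N) (d_ge2 : (2 <= d)%N) :
  ((2 < p <= n)%N ->
     indecomposable (@inv_O F n d) (\tr (\prod_(k < d) genX F n k)) /\
     indecomposable (@inv_O_sym F n d) (\tr (\prod_(k < d) genXsym F n k))) /\
  ((2 < p)%N -> (2 * p <= n - 1)%N -> ~~ odd d ->
     indecomposable (@inv_O_skew F n d) (\tr (\prod_(k < d) genXskew F n k))).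
Proof.
have p0 : p%:R = 0 :> F by apply/eqP; rewrite -(dvdn_pcharf pcharF).
have n_gt0 : (0 < n)%N by apply: ltnW.
case: d d_ge2 => // -[//|d] _; split.
  case/andP=> p_gt2 le_pn; have p_gt0 : (0 < p)%N by lia.
  pose D : 'M[F]_n := pid_mx p; pose E : 'M[F]_n := pid_mx 1.
  have symN k : (pair_family (d := d.+1) D E k)^T = pair_family D E k.
    by rewrite /pair_family; case: ifP; rewrite tr_pid_mx.
  have trD r : \tr (D ^+ r.+1) = 0 by rewrite pid_mxX mxtrace_pid.
  have trDE : \tr (D ^+ d.+1 * E) != 0.
    rewrite pid_mxX -mulmxE mul_pid_mx (minn_idPr p_gt0) (minn_idPr n_gt0).
    by rewrite mxtrace_pid // oner_neq0.
  split.
    rewrite -(big_map (@inl _ 'I_d.+2) xpredT (fun l => match l with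
      inl k => genX F n k | inr k => (genX F n k)^T end)).
    apply: (indecomposable_trace_pair (c := fun l => match l with
      inl k => k | inr k => k end) n_gt0 _ trD trDE).
      2: by rewrite -map_comp map_id.
    by case=> k; [apply: spec_genX | apply: spec_genX_tr].
  apply: (indecomposable_trace_pair (c := id) n_gt0 _ trD trDE).
    2: exact: map_id.
  by move=> k; apply: spec_genXsym.
move=> p_gt2 le_pn even_d.
pose D := skew_blocks F n p; pose E := skew_blocks F n 1.
have le_2p : (p.*2 <= n)%N by lia.
have trD r : \tr (D ^+ r.+1) = 0 by apply: mxtrace_skew_blocksX.
have trDE : \tr (D ^+ d.+1 * E) != 0.
  rewrite -[d]odd_double_half; move: even_d => /=; rewrite negbK => /negPf->.
  rewrite skew_blocksX // -mulmxE -scalemxAl mxtraceZ mxtrace_skew_blocksM //.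
  rewrite (minn_idPr _) ?(ltnW (ltnW p_gt2)) // mulf_neq0 ?signr_eq0 //.
  by rewrite oppr_eq0 -(dvdn_pcharf pcharF) gtnNdvd.
apply: (indecomposable_trace_pair (c := id) n_gt0 _ trD trDE).
  2: exact: map_id.
move=> k; apply: spec_genXskew; rewrite /pair_family; case: ifP => _.
- exact: tr_skew_blocks.
- exact: tr_skew_blocks.
- by move=> i; apply: skew_blocks_diag.
- by move=> i; apply: skew_blocks_diag.
Qed.
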